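(* Let $f$ be a probability density on $[0,1]$ with cumulative distribution function $F(x)=\int_0^x f(t)\,dt$ for $x\in[0,1]$. Then for any integrable function $g:[0,1]\to\mathbb{R}$, $$\int_0^1 f(x)\, g(F(x))\,dx=\int_0^1 g(u)\,du.$$
   Context: A probability density on $[0,1]$ is a nonnegative integrable function $f:[0,1]\to\mathbb{R}$ with $\int_0^1 f(t)\,dt=1$. *)

(* Defs.v *)
From HB Require Import structures.
From mathcomp Require Import all_boot all_order all_algebra.
From mathcomp Require Import all_classical all_reals all_analysis.

Set Implicit Arguments.
Unset Strict Implicit.
Unset Printing Implicit Defensive.

Import Order.TTheory GRing.Theory Num.Theory.
Import numFieldNormedType.Exports.

Local Open Scope classical_set_scope.
Local Open Scope ring_scope.

(* Integrals are taken with respect to the completed Lebesgue measure, so that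
   "integrable" means Lebesgue measurable (and not only Borel measurable) with
   finite integral of the absolute value.
   Functions on [0, 1] are represented by functions on R; only their values on
   [0, 1] matter. *)

Definition integrable01 (R : realType) (h : R -> R) : Prop :=
  (@completed_lebesgue_measure R).-integrable `[0, 1] (EFin \o h).

Definition integral01 (R : realType) (h : R -> R) : R :=
  \int[@completed_lebesgue_measure R]_(x in `[0, 1]) h x.

Definition density01 (R : realType) (f : R -> R) : Prop :=
  [/\ forall x : R, x \in `[0, 1] -> 0 <= f x,
      integrable01 f
    & integral01 f = 1].

Definition cdf01 (R : realType) (f : R -> R) (x : R) : R :=
  \int[@completed_lebesgue_measure R]_(t in `[0, x]) f t.

(* Main.v *)
Require Import Defs.
From HB Require Import structures.
From mathcomp Require Import all_boot all_order all_algebra.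
From mathcomp Require Import all_classical all_reals all_analysis.
From mathcomp Require Import measurable_realfun lra.

(* Let m be the completed Lebesgue measure and P = f m the probability with
   density f. Its distribution function F is continuous, so F pushes P forward
   to the uniform law on Borel sets. For g merely Lebesgue measurable, g o F
   need not be measurable; but replace F by a constant outside {f > 0}. This
   changes F only on a P-null set and leaves f * (g o F) unchanged, and the new
   map Y is measurable from Lebesgue sets to Lebesgue sets: the preimage under F
   of a null set is P-null, so its intersection with {f > 0} is m-null. Hence Y
   pushes P forward to the uniform law on all Lebesgue measurable sets, and the
   claim is the change of variables formula for this pushforward. *)

Set Implicit Arguments.
Unset Strict Implicit.
Unset Printing Implicit Defensive.

Import Order.TTheory GRing.Theory Num.Theory.
Import numFieldNormedType.Exports.

Local Open Scope classical_set_scope.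
Local Open Scope ring_scope.

(** * Finite measures given by an integrable density *)

Definition density_measure d (T : measurableType d) (R : realType)
    (mu : set T -> \bar R) (f : T -> R) (f0 : forall x, 0 <= f x)
    (fi : mu.-integrable setT (EFin \o f)) : set T -> \bar R :=
  fun A => (\int[mu]_(x in A) (f x)%:E)%E.

Section density_measure.
Local Open Scope ereal_scope.
Context d (T : measurableType d) (R : realType).
Variables (mu : {sigma_finite_measure set T -> \bar R}) (f : T -> R).
Hypothesis f0 : forall x, (0 <= f x)%R.
Hypothesis fi : mu.-integrable setT (EFin \o f).

Let density0 : density_measure f0 fi set0 = 0.
Proof. exact: integral_set0. Qed.

Let density_ge0 A : 0 <= density_measure f0 fi A.
Proof. by apply: integral_ge0 => x _; rewrite lee_fin. Qed.

Let density_sigma_additive : semi_sigma_additive (density_measure f0 fi).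
Proof.
apply: (@semi_sigma_additive_nng_induced _ _ _ mu (EFin \o f)) => //.
exact: measurable_int fi.
Qed.

(** Having the proofs [f0] and [fi] as arguments of [density_measure] lets the measure structures be
    attached to this term. *)
HB.instance Definition _ := isMeasure.Build _ _ _ (density_measure f0 fi)
  density0 density_ge0 density_sigma_additive.

Let density_fin : fin_num_fun (density_measure f0 fi).
Proof.
by move=> A mA; apply: integrable_fin_num => //; exact: integrableS fi.
Qed.

HB.instance Definition _ := Measure_isFinite.Build _ _ _ (density_measure f0 fi)
  density_fin.

Lemma null_dominates_density_measure : density_measure f0 fi `<< mu.
Proof.
apply/null_content_dominatesP => A mA muA.
apply: null_set_integral => //; apply: measurable_funTS.
exact: measurable_int fi.
Qed.

(** The Radon-Nikodym derivative of the density measure has the same integral as [f] over every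
    measurable set, so the two agree almost everywhere, and the change of variables for the
    derivative becomes one for [f]. *)
Lemma ge0_integral_density (h : T -> \bar R) : measurable_fun setT h ->
  (forall x, 0 <= h x) ->
  \int[density_measure f0 fi]_x h x = \int[mu]_x (h x * (f x)%:E).
Proof.
move=> mh h0.
pose nu : {finite_measure set T -> \bar R} := density_measure f0 fi.
have numu : nu `<< mu := null_dominates_density_measure.
rewrite -(Radon_Nikodym_SigmaFinite.change_of_variables numu)//.
have gi := Radon_Nikodym_SigmaFinite.f_integrable numu.
have mg := measurable_int _ gi; have mf := measurable_int _ fi.
apply: ae_eq_integral => //; [exact: emeasurable_funM..|].
apply: ae_eqe_mul2l; apply: integral_ae_eq => // E _ mE.
by rewrite -Radon_Nikodym_SigmaFinite.f_integral.
Qed.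

End density_measure.

(** * The probability integral transform on Borel sets *)

Section probability_integral_transform.
Context d (T : measurableType d) (R : realType).
Variables (P : probability T R) (X : {RV P >-> R}).
Let F : R -> R := fine \o cdf X.
Hypothesis F_continuous : continuous F.

Let FE x : (F x)%:E = P (X @^-1` `]-oo, x]).
Proof. by rewrite /F/= fineK// fin_num_measure. Qed.

Let F_nd : nondecreasing_fun F.
Proof. by move=> x y xy; rewrite -lee_fin !FE; exact: cdf_nondecreasing. Qed.

Let F_surj v : 0 < v < 1 -> exists s, F s = v.
Proof.
move=> /andP[v0 v1].
have [b Fb] : exists b, v < F b.
  (* The limit gives a bound only strictly beyond [b], hence the shift by 1. *)
  have := cvg_cdfy1 X; move=> /fine_cvg /(cvgr_gt 1) /(_ v v1) [b [_ bF]].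
  by exists (b + 1); apply: bF; rewrite ltrDl.
have [a Fa] : exists a, F a < v.
  have := cvg_cdfNy0 X; move=> /fine_cvg /(cvgr_lt 0) /(_ v v0) [a [_ aF]].
  by exists (a - 1); apply: aF; rewrite ltrBlDr ltrDl.
have ab : a <= b.
  by rewrite leNgt; apply/negP => /ltW /F_nd; rewrite leNgt (lt_trans Fa).
have [|||c _ Fc] := @IVT _ F a b v => //; last by exists c.
- exact: continuous_subspaceT.
- by rewrite ge_min (ltW Fa)/= le_max (ltW Fb) orbT.
Qed.

Let mFX : measurable_fun setT (F \o X : T -> measurableTypeR R).
Proof.
by apply: measurableT_comp => //; exact: nondecreasing_measurable.
Qed.

(** If [F s = u], monotonicity puts the event inside [X <= s], which has probability [u]; the value
    1 may not be attained, but there the bound is trivial. From below, [F s = u - e] is used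
    instead, so that [X <= s] forces [F X < u] strictly. *)
Let F_ray u : 0 < u <= 1 -> P ((F \o X) @^-1` `]-oo, u[) = u%:E.
Proof.
have mu r : measurable ((F \o X) @^-1` `]-oo, r[).
  by rewrite -[X in measurable X]setTI; apply: mFX.
have mX r : measurable (X @^-1` `]-oo, r]) by exact: measurable_funPTI.
move=> /andP[u0 u1]; apply/eqP; rewrite eq_le; apply/andP; split.
  have [->|un1] := eqVneq u 1; first exact: probability_le1.
  have [|s Fs] := F_surj (v := u); first by rewrite u0 lt_neqAle un1.
  rewrite -Fs FE le_measure ?inE// => x /=; rewrite !in_itv/=.
  by move=> FXs; rewrite leNgt; apply/negP => /ltW /F_nd; rewrite leNgt FXs.
apply/lee_subgt0Pr => _/posnumP[e]; rewrite -EFinD.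
have [ue|eu] := leP (u - e%:num) 0.
  by rewrite (@le_trans _ _ 0%E)// lee_fin.
have [|s Fs] := F_surj (v := u - e%:num).
  by rewrite eu/= (lt_le_trans _ u1)// ltrBlDr ltrDl.
rewrite -Fs FE le_measure ?inE// => x /=; rewrite !in_itv/= => /F_nd.
by rewrite Fs => /le_lt_trans; apply; rewrite ltrBlDr ltrDl.
Qed.

(** Two finite measures agree once they agree on the open rays []-oo, u[], which are stable under
    intersection and generate the Borel sets. [F_ray] treats [0 < u <= 1]; for other [u] both sides
    are 0 or 1 because [F] takes values in [0, 1]. *)
Lemma probability_integral_transform (B : set (measurableTypeR R)) :
  measurable B ->
  P ((F \o X) @^-1` B) = lebesgue_measure (B `&` `[0, 1]).
Proof.
have m01 : measurable (`[0, 1] : set (measurableTypeR R)) by [].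
move=> mB; pose mY := isMeasurableFun.Build _ _ _ _ _ mFX.
pose Y : {mfun T >-> measurableTypeR R} := HB.pack (F \o X) mY.
apply: (@measure_unique _ R (measurableTypeR R) (@RGenInftyO.G R)
  (fun n => `]-oo, n%:R[%classic) _ _ _ _
  (distribution P Y) (mrestr lebesgue_measure m01)) => //.
- exact: RGenInftyO.measurableE.
- move=> _ _ [x ->] [y ->]; exists (Num.min x y); apply/seteqP; split=> z /=;
    by rewrite !in_itv/= lt_min => /andP.
- by move=> n; exists n%:R.
- apply/seteqP; split => // x _; exists (Num.truncn x).+1 => //=.
  by rewrite in_itv/= truncnS_gt.
- move=> _ [u ->]; change (P ((F \o X) @^-1` `]-oo, u[) =
    lebesgue_measure (`]-oo, u[ `&` `[0, 1])).
  have [u0|u0] := leP u 0.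
    rewrite [X in P X](_ : _ = set0) ?measure0; last first.
      apply/seteqP; split => // x /=; rewrite in_itv/= ltNge => /negP; apply.
      by rewrite (le_trans u0)// -lee_fin FE.
    rewrite [X in lebesgue_measure X](_ : _ = set0) ?measure0//.
    apply/seteqP; split => // x [] /=; rewrite !in_itv/= => xu /andP[x0 _].
    by move: (lt_le_trans xu u0); rewrite ltNge x0.
  have [u1|u1] := leP u 1.
    rewrite F_ray ?u0// [X in lebesgue_measure X](_ : _ = `[0, u[%classic).
      by rewrite lebesgue_measure_itv/= lte_fin u0 sube0.
    apply/seteqP; split => x /=; rewrite !in_itv/=.
      by move=> [-> /andP[->]].
    by move=> /andP[-> xu]; split => //; exact/ltW/(lt_le_trans xu).
  rewrite [X in P X](_ : _ = setT) ?probability_setT; last first.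
    apply/seteqP; split => // x _ /=; rewrite in_itv/= (le_lt_trans _ u1)//.
    by rewrite -lee_fin FE; exact: cdf_le1.
  rewrite [X in lebesgue_measure X](_ : _ = `[0, 1]%classic).
    by rewrite lebesgue_measure_itv/= lte_fin ltr01 sube0.
  apply/seteqP; split => x /=; rewrite !in_itv/=; first by case.
  by move=> /andP[-> x1]; split => //; exact: le_lt_trans u1.
- move=> k; apply: (@le_lt_trans _ _ 1%E); last exact: ltry.
  exact: probability_le1.
Qed.

End probability_integral_transform.

(** * Lebesgue measurable sets, compared with Borel sets *)

Definition lebesgueTypeR (R : realType) : measurableType _ :=
  caratheodory_type (mu_ext (@wlength R idfun)).

(** The Carathéodory sets of the outer measure of interval length form the completion of the Borel
    sets, so each is a Borel set joined with part of a Borel null set. *)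
Lemma lebesgueTypeR_sandwich (R : realType) (B : set (lebesgueTypeR R)) :
  measurable B -> exists A Z : set (measurableTypeR R),
  [/\ measurable A, measurable Z, lebesgue_measure Z = 0%E, A `<=` B &
      B `<=` A `|` Z].
Proof.
move=> mB; have : completed_algebra_gen (@lebesgue_measure R) B.
  rewrite -g_sigma_completed_algebra_genE.
  by rewrite completed_caratheodory_measurable.
move=> [A mA [N [Z [mZ Z0 NZ]] <-]]; exists A, Z; split => //.
exact: setUS.
Qed.

(** * The law of the distribution function under a Lebesgue density *)

Section lebesgue_density.
Context (R : realType).
Notation L := (lebesgueTypeR R).
Notation m := (@completed_lebesgue_measure R).
Variable f : L -> R.
Hypothesis f0 : forall x, 0 <= f x.
Hypothesis fi : m.-integrable setT (EFin \o f).
Hypothesis f1 : (\int[m]_x (f x)%:E = 1)%E.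

Lemma measurable_lebesgueTypeR (A : set (measurableTypeR R)) :
  measurable A -> measurable (A : set L).
Proof. exact: sub_caratheodory. Qed.

Let P := density_measure f0 fi.

Let P_setT : P setT = 1%E. Proof. exact: f1. Qed.

HB.instance Definition _ := Measure.on P.
HB.instance Definition _ := Measure_isProbability.Build _ _ _ P P_setT.

(** The identity, from Lebesgue to Borel structure, is a random variable whose [cdf] is the
    distribution function of [P], so the previous transform applies to it. *)
Let X : L -> R := idfun.

Let mX : measurable_fun setT X.
Proof. by move=> _ B mB; rewrite setTI; exact: measurable_lebesgueTypeR. Qed.

HB.instance Definition _ := isMeasurableFun.Build _ _ _ _ X mX.

Let F : R -> R := fine \o cdf (X : {RV P >-> R}).

Let mitv (i : interval R) : measurable ([set` i] : set L).
Proof. by apply: measurable_lebesgueTypeR; exact: measurable_itv. Qed.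

Let FE x : (F x)%:E = P `]-oo, x].
Proof. by rewrite /F/= fineK//; apply: fin_num_measure; exact: mitv. Qed.

Lemma density_measure_itvoc x y : x <= y -> P `]x, y] = (F y - F x)%:E.
Proof.
move=> xy; apply/eqP; rewrite EFinB !FE eq_sym sube_eq ?fin_num_measure//.
- rewrite -measureU//.
    by rewrite setUC -itv_bndbnd_setU.
  apply/seteqP; split => // z [] /=; rewrite !in_itv/= => /andP[xz _].
  by rewrite leNgt xz.
- by rewrite fin_num_adde_defl// fin_num_measure.
Qed.

(** Absolute continuity of the integral: short intervals carry little mass of [f], and increments of
    [F] are such masses. *)
Lemma cdf_density_measure_continuous : continuous F.
Proof.
move=> x; apply/cvgrPdist_lt => e e0.
have [d [d0 dP]] := integral_normr_continuous fi e0.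
have key u v : u <= v -> v - u < d -> F v - F u < e.
  move=> uv vud; rewrite -lte_fin -density_measure_itvoc//.
  have /(dP _ (mitv _)) : (lebesgue_measure `]u, v]%classic < d%:E)%E.
    rewrite lebesgue_measure_itv/= lte_fin.
    by case: ifPn => // _; rewrite -EFinB lte_fin.
  rewrite /Rintegral; under eq_integral do rewrite ger0_norm//.
  by rewrite -lte_fin fineK//; apply: (fin_num_measure P); exact: mitv.
have F_nd u v : u <= v -> F u <= F v.
  by move=> uv; rewrite -subr_ge0 -lee_fin -density_measure_itvoc.
exists d => // y /=; rewrite ltr_norml ltr_norml => /andP[dxy xyd].
have [yx|/ltW xy] := leP y x.
  have := F_nd _ _ yx; have := key _ _ yx xyd; lra.
have := F_nd _ _ xy; have := key _ _ xy; lra.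
Qed.

Let mF (A : set (measurableTypeR R)) : measurable A ->
  measurable (F @^-1` A : set L).
Proof.
move=> mA; apply: measurable_lebesgueTypeR; rewrite -[X in measurable X]setTI.
exact: (continuous_measurable_fun cdf_density_measure_continuous).
Qed.

Let P_F (A : set (measurableTypeR R)) : measurable A ->
  P (F @^-1` A) = lebesgue_measure (A `&` `[0, 1]).
Proof.
exact: (probability_integral_transform cdf_density_measure_continuous).
Qed.

Let S : set L := [set x | 0 < f x].

Let mf : measurable_fun setT f.
Proof. by apply/measurable_EFinP; exact: measurable_int fi. Qed.

Let mS : measurable S.
Proof.
rewrite -[S]setTI [X in _ `&` X](_ : _ = f @^-1` `]0, +oo[); first exact: mf.
by apply/seteqP; split => x /=; rewrite in_itv/= andbT.
Qed.

Let P_S A : measurable A -> P (A `&` S) = P A.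
Proof.
move=> mA; rewrite [RHS](measureDI _ mA mS).
rewrite [X in _ = X + _]integral0_eq ?add0e//.
move=> x [_ /negP]; rewrite -leNgt => fx0.
by congr EFin; apply/eqP; rewrite eq_le fx0 f0.
Qed.

(** A nonnegative function with zero integral over [A] vanishes almost everywhere on [A], so only a
    null part of [A] meets [S]. *)
Let density_measure_null (A : set L) : measurable A -> P A = 0%E ->
  m (A `&` S) = 0%E.
Proof.
move=> mA PA; apply/negligibleP; first exact: measurableI.
have /ae_eq_integral_abs : measurable_fun A (EFin \o f).
  by apply/measurable_EFinP; exact: measurable_funTS.
move=> /(_ m mA) [+ _]; case.
  by under eq_integral do rewrite gee0_abs ?lee_fin//.
move=> N [mN mN0 AN]; exists N; split => // x [Ax Sx]; apply: AN => /=.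
by move=> /(_ Ax) [fx]; move: Sx; rewrite /S/= fx ltxx.
Qed.

Let Y : L -> L := fun x => if 0 < f x then F x else 0.

Let mY : measurable_fun setT Y.
Proof.
move=> _ B mB; rewrite setTI.
have [A [Z [mA mZ Z0 AB BAZ]]] := lebesgueTypeR_sandwich mB.
(* On [S] the preimage splits into a Borel part, over [A], and a remainder over [B] minus [A]; off
   [S], where [Y] is constantly 0, it is everything or nothing. *)
rewrite (_ : _ @^-1` _ = (F @^-1` A `&` S) `|` (F @^-1` (B `\` A) `&` S)
    `|` (~` S `&` [set _ | B 0])); last first.
  apply/seteqP; split => x /=; rewrite /Y /S/=.
    case: ifPn => fx Bx; last by right; split => //; exact/negP.
    by left; have [|] := pselect (A (F x)); [left|right].
  move=> [[[/AB]|[[]]]|[]]; [by move=> ? ->|by move=> ? _ ->|].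
  by move=> /negP/negbTE ->.
apply: measurableU; first apply: measurableU.
- by apply: measurableI => //; exact: mF.
(* The remainder lies in the preimage of [Z], which is [P]-null by [P_F], hence [m]-null within [S];
   completeness makes it measurable. *)
- apply: completed_lebesgue_measure_is_complete.
  exists (F @^-1` Z `&` S); split.
  + by apply: measurableI => //; exact: mF.
  + apply: density_measure_null; first exact: mF.
    rewrite P_F//; apply/eqP; rewrite eq_le measure_ge0 andbT -Z0.
    by apply: le_measure; rewrite ?inE//; exact: measurableI.
  + by move=> x [[/BAZ[]//]].
- apply: measurableI; first exact: measurableC.
  by have [B0|B0] := pselect (B 0); [rewrite (_ : mkset _ = setT)//|
    rewrite (_ : mkset _ = set0)//]; apply/seteqP; split.
Qed.

Let mY_preimage (B : set L) : measurable B -> measurable (Y @^-1` B).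
Proof. by move=> mB; rewrite -[X in measurable X]setTI; exact: mY. Qed.

(** For Borel sets, [Y] and [F] agree on [S], which carries all of [P]. A Lebesgue set is then
    squeezed between [A] and [A] joined with [Z], on which the right-hand side takes the same
    value. *)
Let P_Y B : measurable B -> P (Y @^-1` B) = m (B `&` `[0, 1]).
Proof.
have borel (A : set (measurableTypeR R)) : measurable A ->
    P (Y @^-1` A) = lebesgue_measure (A `&` `[0, 1]).
  move=> mA; rewrite -P_F//.
  rewrite -P_S; last by apply: mY_preimage; exact: measurable_lebesgueTypeR.
  rewrite -[RHS]P_S; last exact: mF.
  congr (P _); apply/seteqP; split => x [] /=; rewrite /Y /S/= => + fx;
    by rewrite fx.
move=> mB; have [A [Z [mA mZ Z0 AB BAZ]]] := lebesgueTypeR_sandwich mB.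
have mI : measurable (`[0, 1] : set (measurableTypeR R)) by [].
have mAZ : measurable (A `|` Z : set (measurableTypeR R)) by exact: measurableU.
have mLI (C : set (measurableTypeR R)) : measurable C ->
    measurable (C `&` `[0, 1] : set L).
  by move=> mC; apply: measurable_lebesgueTypeR; exact: measurableI.
have mBI : measurable (B `&` `[0, 1] : set L).
  by apply: measurableI => //; exact: mitv.
have AZA : (lebesgue_measure ((A `|` Z) `&` `[0%R, 1%R]) <=
    lebesgue_measure (A `&` `[0%R, 1%R]))%E.
  have ZI : lebesgue_measure (Z `&` `[0, 1]) = 0%E.
    by apply: (subset_measure0 _ _ _ Z0) => //; exact: measurableI.
  rewrite setIUl; apply: (le_trans (measureU2 _ _ _)); [exact: measurableI..|].
  by rewrite -[leRHS]adde0; apply: leeD => //; rewrite -ZI.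
apply/eqP; rewrite eq_le; apply/andP; split.
  apply: (@le_trans _ _ (P (Y @^-1` (A `|` Z)))).
    apply: le_measure; rewrite ?inE; [exact: mY_preimage| |].
      by apply: mY_preimage; exact: measurable_lebesgueTypeR.
    exact: preimage_subset.
  rewrite borel// (le_trans AZA)//.
  apply: (@le_measure _ _ _ m); rewrite ?inE//; first exact: mLI.
  exact: setSI.
apply: (@le_trans _ _ (m ((A `|` Z) `&` `[0, 1]))).
  by apply: (@le_measure _ _ _ m); rewrite ?inE//; [exact: mLI|exact: setSI].
apply: (le_trans AZA); rewrite -borel//.
apply: le_measure; rewrite ?inE; [|exact: mY_preimage|exact: preimage_subset].
by apply: mY_preimage; exact: measurable_lebesgueTypeR.
Qed.

HB.instance Definition _ := isMeasurableFun.Build _ _ _ _ Y mY.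

Let F01 x : F x \in `[0, 1].
Proof.
by rewrite in_itv/= -!lee_fin FE probability_le1 ?measure_ge0//; exact: mitv.
Qed.

(** Wherever [Y] differs from [F] the factor [f x] is 0. Restricting [h] is harmless since [F] stays
    in [0, 1], and it turns measurability on [0, 1] into measurability on the line. *)
Let restrictYE (h : L -> \bar R) (x : L) :
  (h (F x) * (f x)%:E = (h \_ `[0%R, 1%R]) (Y x) * (f x)%:E)%E.
Proof.
rewrite /Y; case: ltrP => fx; first by rewrite patchE mem_set//; exact: F01.
by rewrite (_ : f x = 0) ?mule0//; apply/eqP; rewrite eq_le fx f0.
Qed.

Let measurable_restrictY (h : L -> \bar R) :
  measurable_fun (`[0, 1] : set L) h ->
  measurable_fun (setT : set L) (fun x => (h \_ `[0%R, 1%R]) (Y x)).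
Proof.
move=> mh; apply: (measurableT_comp _ mY).
exact/(measurable_restrictT _ (mitv `[0, 1])).
Qed.

(** The composite of [h] with [F] may fail to be measurable; multiplying by [f] allows [Y] to
    replace [F]. The integral in the statement is convertible to [F x], which is local to the
    section. *)
Lemma measurable_comp_cdfM (h : L -> \bar R) :
  measurable_fun (`[0, 1] : set L) h ->
  measurable_fun (setT : set L)
    (fun x => h (\int[m]_(t in `]-oo, x]) f t)%R * (f x)%:E)%E.
Proof.
move=> mh; rewrite -[X in measurable_fun _ X]/(fun x => h (F x) * (f x)%:E)%E.
under eq_fun do rewrite restrictYE.
apply: emeasurable_funM; first exact: measurable_restrictY.
exact/measurable_EFinP.
Qed.

(** The factor [f] is absorbed into [P], then the integral is pushed forward along [Y], whose law is
    [m] on [0, 1] by [P_Y]. *)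
Lemma ge0_integral_comp_cdf (h : L -> \bar R) :
  measurable_fun (`[0, 1] : set L) h -> (forall x, 0 <= h x)%E ->
  (\int[m]_x (h (\int[m]_(t in `]-oo, x]) f t)%R * (f x)%:E) =
   \int[m]_(u in `[0%R, 1%R]) h u)%E.
Proof.
move=> mh h0; rewrite -[LHS]/(\int[m]_x (h (F x) * (f x)%:E))%E.
under eq_integral do rewrite restrictYE.
have hI0 x : (0 <= (h \_ `[0%R, 1%R]) x)%E by exact: erestrict_ge0.
rewrite -(@ge0_integral_density _ _ _ _ _ f0 fi
  (fun x => (h \_ `[0%R, 1%R]) (Y x)))//.
  rewrite -[LHS](@ge0_integral_pushforward _ _ _ _ _ _ mY P setT
    (h \_ `[0%R, 1%R]))//.
    rewrite -integral_mkcond.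
    rewrite -[LHS]/(\int[distribution P Y]_(x in `[0%R, 1%R]) h x)%E.
    apply: eq_measure_integral => A mA AI.
    by rewrite -[LHS]/(P (Y @^-1` A)) P_Y// setIidl.
  exact/(measurable_restrictT _ (mitv `[0, 1])).
exact: measurable_restrictY.
Qed.

(** * Integrands of arbitrary sign *)

Section integrable.
Variable g : L -> R.
Hypothesis gi : m.-integrable `[0, 1] (EFin \o g).

Let mg : measurable_fun (`[0, 1] : set L) (EFin \o g).
Proof. exact: measurable_int gi. Qed.

Lemma integrable_comp_cdf : m.-integrable (setT : set L)
  (fun x => (g (\int[m]_(t in `]-oo, x]) f t)%R * f x)%:E).
Proof.
apply/integrableP; split; first exact: (measurable_comp_cdfM mg).
under eq_integral do rewrite EFinM abseM (@gee0_abs _ (f _)%:E) ?lee_fin//.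
rewrite (@ge0_integral_comp_cdf (abse \o EFin \o g))//.
- by move/integrableP : gi => [].
- exact: (measurableT_comp _ mg).
- by move=> x; exact: abse_ge0.
Qed.

(** Since [f] is nonnegative it factors out of positive and negative parts, and the nonnegative case
    applies to each part. *)
Lemma integral_comp_cdf :
  (\int[m]_x (g (\int[m]_(t in `]-oo, x]) f t)%R * f x)%:E =
   \int[m]_(u in `[0%R, 1%R]) (g u)%:E)%E.
Proof.
rewrite integralE [RHS]integralE; congr (_ - _)%E.
  rewrite -(@ge0_integral_comp_cdf (EFin \o g)^\+%E)//; last first.
    exact: measurable_funepos.
  by apply: eq_integral => x _; rewrite !funeposE maxe_pMl ?lee_fin// mul0e.
rewrite -(@ge0_integral_comp_cdf (EFin \o g)^\-%E)//; last first.
  exact: measurable_funeneg.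
by apply: eq_integral => x _; rewrite !funenegE maxe_pMl ?lee_fin// mul0e mulNe.
Qed.

End integrable.

End lebesgue_density.

(** * Transfer from the line to the unit interval *)

Theorem proposition5p1 (R : realType) (f : R -> R) (hf : density01 f)
    (g : R -> R) (hg : integrable01 g) :
  integrable01 (fun x => f x * g (cdf01 f x)) /\
  integral01 (fun x => f x * g (cdf01 f x)) = integral01 g.
Proof.
case: hf => f0 fi f1; pose L := lebesgueTypeR R.
have mI : measurable (`[0, 1] : set L).
  by apply: measurable_lebesgueTypeR; exact: measurable_itv.
(* Extension by zero gives a density on the whole line; on [0, 1] its distribution function is
   [cdf01 f]. *)
pose f' : L -> R := f \_ `[0, 1].
have f'0 x : 0 <= f' x.
  by apply: restrict_ge0 => y yI; exact: f0.
have f'i : (@completed_lebesgue_measure R).-integrable setT (EFin \o f').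
  by rewrite /f' -restrict_EFin; exact/(integrable_mkcond _ mI).
have f'1 : (\int[@completed_lebesgue_measure R]_x (f' x)%:E = 1)%E.
  transitivity
    (\int[@completed_lebesgue_measure R]_(x in `[0%R, 1%R]) (f x)%:E)%E.
    by rewrite [RHS]integral_mkcond restrict_EFin.
  by rewrite -[LHS]fineK ?(integrable_fin_num mI fi)//; congr EFin; exact: f1.
have FE x : x \in `[0, 1] ->
    \int[@completed_lebesgue_measure R]_(t in `]-oo, x]) f' t = cdf01 f x.
  rewrite in_itv/= => /andP[x0 x1].
  rewrite /cdf01 -Rintegral_mkcondr; congr Rintegral.
  apply/seteqP; split => t /=; rewrite !in_itv/=.
    by move=> [-> /andP[->]].
  by move=> /andP[-> tx]; split => //; exact: le_trans x1.
(* Off [0, 1] both sides vanish: the left one by restriction, the right one through [f']. *)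
have E : (fun x => f x * g (cdf01 f x)) \_ `[0, 1] = fun x : L =>
    g (\int[@completed_lebesgue_measure R]_(t in `]-oo, x]) f' t) * f' x.
  apply/funext => x; rewrite /f' !patchE.
  case: ifPn => xI; last by rewrite mulr0.
  by rewrite -/f' mulrC FE// -inE.
split.
  apply/(integrable_mkcond _ mI).
  by rewrite restrict_EFin E; exact: integrable_comp_cdf.
rewrite /integral01 Rintegral_mkcond E /Rintegral; congr fine.
exact: integral_comp_cdf.
Qed.
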